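(* Let $X,Y$ be Banach spaces and let $u:\mathbb{R}_{\ge 0}\to\mathcal{L}(X;Y)$ be a function. Then the following are equivalent: (a) for each $x\in X$ there is $t_x\ge 0$ such that the orbit $u_x$ is real analytic on $(t_x,\infty)$; (b) there is $t\ge 0$ such that for all $x\in X$ the orbit $u_x$ is real analytic on $(t,\infty)$.
   Context: $X,Y$ are Banach spaces over the same field $\mathbb{R}$ or $\mathbb{C}$; $\mathcal{L}(X;Y)$ is the space of bounded linear operators from $X$ to $Y$; $\mathbb{R}_{\ge 0}=[0,\infty)$. No continuity or other regularity of $u$ is assumed. For $x\in X$, the orbit is the function $u_x:\mathbb{R}_{\ge 0}\to Y$, $u_x(t)=u(t)x$. A $Y$-valued function $f$ on an open set $U\subseteq\mathbb{R}$ is real analytic at $t_0\in U$ if there are $r>0$ and a sequence $(y_k)_{k\ge 0}$ in $Y$ such that $f(t)=\sum_{k=0}^\infty (t-t_0)^k y_k$ (convergent) for all $t\in(t_0-r,t_0+r)$; it is real analytic on a set $W\subseteq U$ if it is real analytic at each point of $W$. *)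

(* Defs.v *)
From HB Require Import structures.
From mathcomp Require Import all_boot all_order all_algebra.
From mathcomp Require Import complex.
From mathcomp Require Import all_classical all_reals all_analysis.

Set Implicit Arguments.
Unset Strict Implicit.
Unset Printing Implicit Defensive.

Import Order.TTheory GRing.Theory Num.Theory.
Import numFieldNormedType.Exports.

Local Open Scope classical_set_scope.
Local Open Scope ring_scope.

(* The scalar field K is the field R of real numbers or its complexification
   R[i]; iota is the canonical embedding of the reals, through which real
   numbers act on vector spaces over K. *)
Variant real_or_complex (R : realType) :
    forall K : numFieldType, (R -> K) -> Prop :=
  | RealScalars : @real_or_complex R R idfun
  | ComplexScalars : real_or_complex (real_complex R).

Record bounded_operator (K : numFieldType) (X Y : normedModType K) :=
  BoundedOperator {
    bounded_operator_fun :> {linear X -> Y} ;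
    bounded_operatorP :
      exists M : K, forall x : X, `|bounded_operator_fun x| <= M * `|x|
  }.

Lemma bounded_operator_continuous (K : numFieldType) (X Y : normedModType K)
    (T : bounded_operator X Y) : continuous T.
Proof.
apply/linear_bounded_continuous/bounded_funP => r.
have [M HM] := bounded_operatorP T.
exists (`|M| * r) => x xr; have := HM x => /le_trans; apply.
have Mx : 0 <= M * `|x| by exact: le_trans (HM x).
by rewrite -(ger0_norm Mx) normrM normr_id ler_wpM2l.
Qed.

(* A function on U is represented by a total function f on R; since the
   interval of convergence is required to lie in U, the values of f outside U
   are irrelevant. *)
Definition real_analytic_at (R : realType) (K : numFieldType) (iota : R -> K)
    (Y : normedModType K) (U : set R) (f : R -> Y) (t0 : R) : Prop :=
  exists r : R, exists y : nat -> Y,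
    [/\ 0 < r,
        `]t0 - r, t0 + r[ `<=` U &
        forall t : R, t \in `]t0 - r, t0 + r[ ->
          series (fun k => iota (t - t0) ^+ k *: y k) @ \oo --> f t].

Definition real_analytic_on (R : realType) (K : numFieldType) (iota : R -> K)
    (Y : normedModType K) (U W : set R) (f : R -> Y) : Prop :=
  forall t0 : R, W t0 -> real_analytic_at iota U f t0.

(* For t >= 0 this is u(t)x; the even extension to t < 0 is a dummy value,
   analyticity being only considered on subsets of `]0, +oo[. *)
Definition op_orbit (R : realType) (K : numFieldType) (X Y : normedModType K)
    (u : {nonneg R} -> bounded_operator X Y) (x : X) (t : R) : Y :=
  u (`|t|%:nng) x.

Lemma op_orbitE (R : realType) (K : numFieldType) (X Y : normedModType K)
    (u : {nonneg R} -> bounded_operator X Y) (x : X) (t : {nonneg R}) :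
  op_orbit u x t%:num = u t x.
Proof.
rewrite /op_orbit; congr (bounded_operator_fun (u _) x).
by apply: val_inj => /=; rewrite ger0_norm.
Qed.

(* Main.v *)
Require Import Defs.
From HB Require Import structures.
From mathcomp Require Import all_boot all_order all_algebra.
From mathcomp Require Import complex.
From mathcomp Require Import all_classical all_reals all_analysis.
From mathcomp Require Import ring.

Set Implicit Arguments.
Unset Strict Implicit.
Unset Printing Implicit Defensive.

Import Order.TTheory GRing.Theory Num.Theory.
Import numFieldNormedType.Exports.

Local Open Scope classical_set_scope.
Local Open Scope ring_scope.

(** Call an orbit m-bounded at t0 when its Taylor remainders at t0 satisfy
      |f (t0 + s) - sum_(k < N) s^k y_k| <= (m+1) ((m+1) |s|)^N
    for some coefficients y_k, for all N and all s with (m+1) |s| < 1.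
    For t0 > 0, an orbit is analytic at t0 if and only if it is m-bounded for
    some m ([real_analytic_taylor_bounded], [taylor_bounded_real_analytic]), so the
    vectors whose orbit is analytic at t0 form the union over m of the sets
    A(t0, m) of vectors with an m-bounded orbit.  Each A(t0, m) is closed
    ([closed_taylor_bounded]): the values u(t)x depend continuously on x, and
    the coefficients can be recovered one after the other from values of the
    orbit, with an error controlled by m alone ([taylor_bounded_lim]).

    The vectors whose orbit is analytic at t0 also form a linear subspace;
    hence, if some A(t0, m) contains a ball, then every orbit is analytic at
    t0 ([real_analytic_at_of_ball]).

    Suppose now that (a) holds and (b) fails.  As (b) fails, every natural
    number n lies below some t_n at which at least one orbit is not analytic,
    so that no A(t_n, m) contains a ball.  By (a) the orbit of a given x is
    analytic at t_n as soon as n exceeds t_x, so that X is the union of the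
    closed sets A(t_n, m) over all n and m, which contradicts Baire's theorem
    ([baire_closed_cover]).  Applying Baire to the pairs (n, m) at once avoids
    discussing the subspace of vectors whose orbit is analytic beyond n, which
    need not be closed. *)

(** * The scalar field *)

(** The lemmas of this part are the only ones where the real and the complex
    cases are told apart.  The field K is only partially ordered in the complex
    case, but its nonnegative elements are images of real numbers, which gives
    the Archimedean arguments used later. *)
Lemma scalar_embedding_rmorphism (R : realType) (K : numFieldType)
    (iota : R -> K) (KRC : real_or_complex iota) :
  exists h : {rmorphism R -> K}, iota = h.
Proof. by case: KRC; [exists idfun | exists (real_complex R)]. Qed.

Lemma scalar_embedding_norm (R : realType) (K : numFieldType)
    (iota : R -> K) (KRC : real_or_complex iota) (s : R) :
  `|iota s| = iota `|s|.
Proof.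
case: KRC => //=.
by rewrite normc_def/= expr0n/= addr0 sqrtr_sqr.
Qed.

Lemma scalar_embedding_lt (R : realType) (K : numFieldType)
    (iota : R -> K) (KRC : real_or_complex iota) (a b : R) :
  (iota a < iota b) = (a < b).
Proof. by case: KRC => //=; rewrite ltcR. Qed.

Lemma scalar_ge0_embedding (R : realType) (K : numFieldType)
    (iota : R -> K) (KRC : real_or_complex iota) (x : K) :
  0 <= x -> exists r : R, x = iota r.
Proof.
case: KRC x => [x _|[a b]]; first by exists x.
by rewrite lecE/= => /andP[/eqP -> _]; exists a.
Qed.

Lemma scalar_archimedean (R : realType) (K : numFieldType) (iota : R -> K)
    (KRC : real_or_complex iota) (x : K) :
  0 <= x -> exists n : nat, x < n%:R.
Proof.
move=> /(scalar_ge0_embedding KRC)[r ->].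
have [h ih] := scalar_embedding_rmorphism KRC.
exists (Num.truncn r).+1.
have -> : (Num.truncn r).+1%:R = iota (Num.truncn r).+1%:R :> K.
  by rewrite ih rmorph_nat.
by rewrite (scalar_embedding_lt KRC) truncnS_gt.
Qed.

Lemma scalar_small_inverse (R : realType) (K : numFieldType) (iota : R -> K)
    (KRC : real_or_complex iota) (e : K) :
  0 < e -> exists n : nat, n.+1%:R^-1 < e.
Proof.
move=> e0; have [|n en] := scalar_archimedean KRC (x := e^-1).
  by rewrite invr_ge0 ltW.
exists n; rewrite -[e]invrK ltf_pV2 ?posrE ?invr_gt0 ?ltr0n//.
by rewrite (lt_le_trans en)// ler_nat.
Qed.

Lemma scalar_cvg_expr (R : realType) (K : numFieldType) (iota : R -> K)
    (KRC : real_or_complex iota) (q e : K) :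
  0 <= q -> q < 1 -> 0 < e -> \forall n \near \oo, q ^+ n < e.
Proof.
move=> q0 q1 e0.
have [r qr] := scalar_ge0_embedding KRC q0.
have [d ed] := scalar_ge0_embedding KRC (ltW e0).
have [h ih] := scalar_embedding_rmorphism KRC.
have d0 : 0 < d by rewrite -(scalar_embedding_lt KRC) -ed ih rmorph0.
have r1 : `|r| < 1.
  rewrite -(scalar_embedding_lt KRC) -(scalar_embedding_norm KRC) -qr.
  by rewrite ih rmorph1 ger0_norm.
have /cvgrPdist_lt/(_ _ d0) := cvg_expr r1.
apply: filterS => n; rewrite sub0r normrN => rd.
rewrite qr ed ih -rmorphXn -ih (scalar_embedding_lt KRC).
exact: le_lt_trans (ler_norm _) rd.
Qed.

(** * Sequences and closed sets in normed spaces *)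

Lemma norm_lim_le (K : numFieldType) (V : normedModType K) (v : nat -> V)
    (l : V) (c : K) :
  v @ \oo --> l -> (\forall n \near \oo, `|v n| <= c) -> `|l| <= c.
Proof.
move=> vl vc; apply/ler_addgt0Pl => e e0.
near \oo => n.
rewrite -[l](subrK (v n)) (le_trans (ler_normD _ _))// lerD//; last by near: n.
by near: n; exact: cvgr_dist_le.
Unshelve. all: by end_near. Qed.

(** Up to any error, uniform in the index, the sequence is a convergent one,
    hence it is Cauchy.  This is how Taylor coefficients are shown to converge,
    the approximants being difference quotients at a fixed step. *)
Lemma cvgn_uniform_approx (K : numFieldType) (V : completeNormedModType K)
    (v : nat -> V) :
  (forall e : K, 0 < e -> exists2 g : nat -> V,
     cvgn g & forall j, `|g j - v j| < e) -> cvgn v.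
Proof.
move=> vP; suff : cauchy_ex (v @ \oo) by move=> /cauchy_exP/cauchy_cvg.
move=> e e0; have e20 : 0 < e / 2 by rewrite divr_gt0.
have [g cg gv] := vP _ e20; exists (lim (g @ \oo)).
have /cvgrPdist_lt/(_ _ e20) := cg.
apply: filterS => j gj; rewrite -ball_normE/=.
by rewrite (splitr e) -(subrKA (g j)) (le_lt_trans (ler_normD _ _))// ltrD.
Qed.

(** The balls of radius 1/(j+1) form a neighbourhood basis, the scalars being
    Archimedean. *)
Lemma closed_sequentially (R : realType) (K : numFieldType) (iota : R -> K)
    (KRC : real_or_complex iota) (V : normedModType K) (A : set V) :
  (forall (v : nat -> V) (l : V),
     (forall j, A (v j)) -> v @ \oo --> l -> A l) ->
  closed A.
Proof.
move=> seqA l clAl.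
have /choice[v vP] : forall j : nat, exists v : V, A v /\ `|l - v| < j.+1%:R^-1.
  move=> j; have [|v [Av lv]] := clAl (ball l j.+1%:R^-1).
    by apply: nbhsx_ballx; rewrite invr_gt0.
  by exists v; split => //; move: lv; rewrite -ball_normE.
apply: (seqA v) => [j|]; first by have [] := vP j.
apply/cvgrPdist_lt => e /(scalar_small_inverse KRC)[n ne].
exists n => // j /= nj; apply: lt_trans (proj2 (vP j)) _.
by apply: le_lt_trans ne; rewrite lef_pV2 ?posrE ?ltr0n// ler_nat.
Qed.

(** Baire's theorem over real or complex scalars.  If no [A i] contains a
    ball, then any ball contains a closed ball that misses [A i]; iterating,
    the centers of nested closed balls converge to a point outside all the
    [A i].  Radii have the form 1/(k+1), k natural, which makes them
    comparable although K need not be totally ordered. *)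
Lemma baire_closed_cover (R : realType) (K : numFieldType) (iota : R -> K)
    (KRC : real_or_complex iota) (X : completeNormedModType K)
    (A : nat -> set X) :
  (forall i, closed (A i)) -> (forall x, exists i, A i x) ->
  exists i x0, exists2 e : K, 0 < e & ball x0 e `<=` A i.
Proof.
move=> clA covA; apply: contrapT => noball.
have step (i : nat) (p : X * nat) : exists q : X * nat,
    [/\ `|p.1 - q.1| + q.2.+1%:R^-1 <= p.2.+1%:R^-1,
        (i < q.2)%N &
        forall z, `|q.1 - z| <= q.2.+1%:R^-1 -> ~ A i z].
  case: p => x k.
  have k0 : 0 < k.+1%:R^-1 / 2 :> K by rewrite divr_gt0.
  have [x' [xx' NAx']] : exists x', ball x (k.+1%:R^-1 / 2) x' /\ ~ A i x'.
    apply: contrapT => Nx; apply: noball.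
    exists i, x, (k.+1%:R^-1 / 2) => // z xz.
    by apply: contrapT => NAz; apply: Nx; exists z.
  have : nbhs x' (~` A i).
    by apply: open_nbhs_nbhs; split => //; exact: closed_openC.
  move=> /nbhs_ballP[d /= d0 dA].
  have [n nd] := scalar_small_inverse KRC d0.
  (* Large enough for the new ball to miss [A i] and to lie in the old one, and
     for the radii to tend to 0. *)
  pose m := (n + i.+1 + k.+1.*2)%N.
  have mV (j : nat) : (j <= m)%N -> m.+1%:R^-1 <= j.+1%:R^-1 :> K.
    by move=> jm; rewrite lef_pV2 ?posrE ?ltr0n// ler_nat.
  exists (x', m); split => /=.
  - rewrite [leRHS]splitr lerD//.
      by rewrite ltW//; move: xx'; rewrite -ball_normE.
    rewrite -invfM -natrM lef_pV2 ?posrE ?ltr0n ?muln_gt0// ler_nat muln2.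
    by rewrite (leq_trans _ (leqnSn _))// leq_addl.
  - by rewrite /m -addnA addnCA leq_addr.
  - move=> z zx'; apply: (dA z); rewrite -ball_normE /=.
    apply: le_lt_trans zx' _; apply: le_lt_trans nd.
    by apply: mV; rewrite /m -addnA leq_addr.
have /choice[f fP] : forall ip : nat * (X * nat), exists q : X * nat,
    [/\ `|ip.2.1 - q.1| + q.2.+1%:R^-1 <= ip.2.2.+1%:R^-1,
        (ip.1 < q.2)%N &
        forall z, `|q.1 - z| <= q.2.+1%:R^-1 -> ~ A ip.1 z].
  by move=> [i p]; exact: step.
pose a := fix a n := if n is p.+1 then f (p, a p) else (0 : X, 0%N).
have aE n : a n.+1 = f (n, a n) by [].
have nested n j : `|(a n).1 - (a (n + j)%N).1| + (a (n + j)%N).2.+1%:R^-1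
    <= (a n).2.+1%:R^-1.
  elim: j => [|j ih]; first by rewrite addn0 subrr normr0 add0r.
  rewrite addnS (le_trans _ ih)//.
  have [+ _ _] := fP ((n + j)%N, a (n + j)%N).
  rewrite -aE/= => aj.
  rewrite (le_trans _ (lerD (lexx _) aj))// addrA lerD2r.
  by rewrite (le_trans _ (ler_normD _ _))// addrA subrK.
have near_a n j : `|(a n).1 - (a (n + j)%N).1| <= (a n).2.+1%:R^-1.
  by apply: le_trans (nested n j); rewrite lerDl invr_ge0.
have /cvg_ex[l al] : cvgn (fun n => (a n).1).
  apply: cauchy_cvg; apply: cauchy_exP => e /(scalar_small_inverse KRC)[n ne].
  exists (a n.+1).1; exists n.+1 => // j /= nj.
  have := near_a n.+1 (j - n.+1)%N; rewrite subnKC// -ball_normE/=.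
  move=> /le_lt_trans; apply.
  apply: le_lt_trans ne; rewrite lef_pV2 ?posrE ?ltr0n// ler_nat.
  by have [_ /= /ltnW] := fP (n, a n).
have [i Ail] := covA l.
have [_ _ /(_ l)] := fP (i, a i); apply => //.
rewrite -aE; apply: (@norm_lim_le _ _ (fun n => (a i.+1).1 - (a n).1)).
  exact: cvgB (cvg_cst _) al.
by exists i.+1 => // n /= ni; have := near_a i.+1 (n - i.+1)%N; rewrite subnKC.
Qed.

(** * Taylor expansions with uniformly bounded remainders *)

(** Bounding remainders, rather than coefficients, keeps infinite sums out of
    the definition: it consists of inequalities between finitely many values,
    which are preserved by pointwise limits. *)
Definition taylor_bounded (R : realType) (K : numFieldType) (iota : R -> K)
    (Y : normedModType K) (m : nat) (f : R -> Y) (t0 : R) (y : nat -> Y) :=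
  forall (s : R) (N : nat), m.+1%:R * `|iota s| < 1 ->
    `|f (t0 + s) - \sum_(0 <= k < N) iota s ^+ k *: y k|
      <= m.+1%:R * (m.+1%:R * `|iota s|) ^+ N.

(** For 2 q <= 1 the sum of c q^k over k >= N is at most 2 c q^N.  The
    induction needs the stronger bound 2 c q^N - 2 c q^(N+j). *)
Lemma geometric_tail_le (K : numFieldType) (V : normedModType K)
    (v : nat -> V) (c q : K) (N j : nat) :
  0 <= c -> 0 <= q -> 2 * q <= 1 -> (forall k, `|v k| <= c * q ^+ k) ->
  `|\sum_(N <= k < N + j) v k| <= 2 * c * q ^+ N.
Proof.
move=> c0 q0 q1 vq.
suff: `|\sum_(N <= k < N + j) v k| <= 2 * c * q ^+ N - 2 * c * q ^+ (N + j).
  by move=> /le_trans; apply; rewrite gerBl !mulr_ge0// exprn_ge0.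
elim: j => [|j ih]; first by rewrite addn0 big_geq// subrr normr0.
rewrite addnS big_nat_recr ?leq_addr//=.
apply: le_trans (ler_normD _ _) _; apply: le_trans (lerD ih (vq _)) _.
rewrite -addrA lerD2l exprS -subr_ge0.
rewrite (_ : _ - _ = (c * q ^+ (N + j)) * (1 - 2 * q)); last by ring.
by rewrite !mulr_ge0 ?exprn_ge0 ?subr_ge0.
Qed.

(** The series converges at half its radius r, so its terms there are bounded
    by some c, that is |y_k| <= c / (r/2)^k.  For |s| <= r/4 the remainders are
    then dominated by geometric tails of ratio |s| / (r/2) <= 1/2. *)
Lemma real_analytic_taylor_bounded (R : realType) (K : numFieldType)
    (iota : {rmorphism R -> K}) (KRC : real_or_complex iota)
    (Y : normedModType K) (U : set R) (f : R -> Y) (t0 : R) :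
  real_analytic_at iota U f t0 -> exists m y, taylor_bounded iota m f t0 y.
Proof.
move=> [r [y [r0 _ fy]]].
have fs (s : R) : `|s| < r ->
    series (fun k => iota s ^+ k *: y k) @ \oo --> f (t0 + s).
  move=> sr; have := fy (t0 + s).
  have -> : t0 + s - t0 = s by rewrite addrC addKr.
  by apply; rewrite in_itv/= -ltr_distlC opprD addNKr normrN.
have r20 : 0 < r / 2 by rewrite divr_gt0.
have ir0 : 0 < iota (r / 2).
  by rewrite -(rmorph0 iota) (scalar_embedding_lt KRC).
have /cvg_seq_bounded[M [Mreal MP]] :
    cvgn (fun k => iota (r / 2) ^+ k *: y k).
  apply/cvg_ex; exists 0; apply: cvg_series_cvg_0.
  by apply/cvg_ex; exists (f (t0 + r / 2)); apply: fs;
    rewrite gtr0_norm// gtr_pMr// invf_lt1// ltr1n.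
have [c Mc] := scalar_archimedean KRC (normr_ge0 M).
have {MP Mreal M Mc} yc k : `|y k| <= c%:R / iota (r / 2) ^+ k.
  rewrite ler_pdivlMr ?exprn_gt0// mulrC.
  rewrite -[X in X * _]gtr0_norm ?exprn_gt0//.
  rewrite -normrZ; apply: (MP c%:R _ k I).
  exact: le_lt_trans (real_ler_norm Mreal) Mc.
have [|d dr] := scalar_archimedean KRC (x := 2 / iota (r / 2)).
  by rewrite divr_ge0// ltW.
(* The term 2 c bounds the geometric tails; d makes q <= 1/2, and puts s in the
   disc of convergence, as soon as (m+1) |s| < 1. *)
pose m := (c.*2 + d)%N.
exists m, y => s N ms.
have m2r : 2 / iota (r / 2) <= m.+1%:R.
  rewrite (le_trans (ltW dr))// ler_nat /m -addnS.
  by rewrite (leq_trans (leqnSn _))// leq_addl.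
pose q := `|iota s| / iota (r / 2).
have q0 : 0 <= q by rewrite divr_ge0// ltW.
have qm : 2 * q <= m.+1%:R * `|iota s|.
  by rewrite /q mulrCA mulrC ler_wpM2r.
have sr : `|s| < r.
  rewrite -(scalar_embedding_lt KRC) -(scalar_embedding_norm KRC).
  have : 2 * q < 1 by apply: le_lt_trans qm ms.
  rewrite /q mulrA ltr_pdivrMr// mul1r => /ltW.
  have -> : iota (r / 2) = iota r / 2 by rewrite fmorph_div rmorph_nat.
  have ir : 0 < iota r by rewrite -(rmorph0 iota) (scalar_embedding_lt KRC).
  rewrite ler_pdivlMr// => sr; apply: le_lt_trans (_ : _ <= iota r / (2 * 2)) _.
    by rewrite ler_pdivlMr// mulrCA mulrA.
  by rewrite gtr_pMr// invf_lt1// -natrM ltr1n.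
have tail j : `|\sum_(N <= k < N + j) iota s ^+ k *: y k| <= 2 * c%:R * q ^+ N.
  apply: geometric_tail_le => //.
    exact: le_trans qm (ltW ms).
  move=> k; rewrite normrZ normrX (le_trans (ler_wpM2l _ (yc k))) ?exprn_ge0//.
  by rewrite mulrCA -expr_div_n.
apply: (@le_trans _ _ (2 * c%:R * q ^+ N)).
  apply: (@norm_lim_le _ _ (fun n => series (fun k => iota s ^+ k *: y k) n -
      \sum_(0 <= k < N) iota s ^+ k *: y k)).
    exact: cvgB (fs _ sr) (cvg_cst _).
  exists N => // n /= Nn; rewrite /series/= (big_cat_nat (n := N))//=.
  by rewrite addrAC subrr add0r -(subnKC Nn); exact: tail.
rewrite ler_pM ?mulr_ge0 ?exprn_ge0//.
  by rewrite -natrM ler_nat mul2n /m -addnS leq_addr.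
apply: lerXn2r; rewrite ?nnegrE//.
by apply: le_trans qm; rewrite ler_peMl// ler1n.
Qed.

(** The power series converges because its remainders are at most
    (m+1) q^N with q = (m+1) |s| < 1; the radius is cut down to t0 in order
    to stay among positive times. *)
Lemma taylor_bounded_real_analytic (R : realType) (K : numFieldType)
    (iota : {rmorphism R -> K}) (KRC : real_or_complex iota)
    (Y : normedModType K) (m : nat) (f : R -> Y) (t0 : R) (y : nat -> Y) :
  0 < t0 -> taylor_bounded iota m f t0 y ->
  real_analytic_at iota `]0, +oo[ f t0.
Proof.
move=> t00 fy; exists (Order.min m.+1%:R^-1 t0), y; split.
- by rewrite lt_min t00 invr_gt0 ltr0n.
- move=> t /=; rewrite !in_itv/= andbT => /andP[tt _].
  by apply: le_lt_trans tt; rewrite subr_ge0 ge_min lexx orbT.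
move=> t; rewrite in_itv/= -ltr_distlC distrC lt_min => /andP[tm _].
have ms : m.+1%:R * `|iota (t - t0)| < 1.
  rewrite mulrC -ltr_pdivlMr// mul1r (scalar_embedding_norm KRC).
  by rewrite -(rmorph_nat iota) -fmorphV (scalar_embedding_lt KRC).
have m0 : 0 < m.+1%:R :> K by rewrite ltr0n.
apply/cvgrPdist_lt => e e0.
have := scalar_cvg_expr KRC (mulr_ge0 (ltW m0) (normr_ge0 _)) ms
  (divr_gt0 e0 m0).
apply: filterS => N; rewrite ltr_pdivlMr// mulrC => Ne.
by have := fy _ N ms; rewrite [t0 + _]addrC subrK => /le_lt_trans; apply.
Qed.

(** Each coefficient y_k of [f j] converges as j grows, by induction on k:
    [(f j (t0 + s) - sum_(i < k) s^i y_i) / s^k] converges for fixed s, by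
    the induction hypothesis, and differs from y_k by at most
    (m+1)^(k+2) |s|, uniformly in j.  The remainder bounds then pass to the
    limit. *)
Lemma taylor_bounded_lim (R : realType) (K : numFieldType)
    (iota : {rmorphism R -> K}) (KRC : real_or_complex iota)
    (Y : completeNormedModType K) (m : nat) (f : nat -> R -> Y) (g : R -> Y)
    (t0 : R) (y : nat -> nat -> Y) :
  (forall j, taylor_bounded iota m (f j) t0 (y j)) ->
  (forall t, f ^~ t @ \oo --> g t) ->
  exists z, taylor_bounded iota m g t0 z.
Proof.
move=> fy fg.
have cvg_sum_lim (a : nat -> K) N : (forall k, (k < N)%N -> cvgn (y ^~ k)) ->
    (fun j => \sum_(0 <= k < N) a k *: y j k) @ \oo -->
    \sum_(0 <= k < N) a k *: lim (y ^~ k @ \oo).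
  elim: N => [_|N ih cy].
    by rewrite big_geq//; under eq_fun do rewrite big_geq//; exact: cvg_cst.
  rewrite big_nat_recr//=; under eq_fun do rewrite big_nat_recr//=.
  apply: cvgD; first by apply: ih => k kN; apply: cy; rewrite ltnS ltnW.
  by apply: cvgZr; exact: cy.
have cy k : cvgn (y ^~ k).
  elim/ltn_ind: k => k ih; apply: cvgn_uniform_approx => e e0.
  pose B : K := m.+1%:R * m.+1%:R ^+ k.+1.
  have B0 : 0 < B by rewrite mulr_gt0// exprn_gt0.
  have [n ne] := scalar_small_inverse KRC (divr_gt0 e0 B0).
  (* Small enough for [t0 + s] to be covered by the remainder bound, and for
     the error B s to be less than e. *)
  pose s : R := (n + m.+1).+1%:R^-1.
  have iotas : iota s = (n + m.+1).+1%:R^-1 by rewrite fmorphV rmorph_nat.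
  have s0 : 0 < iota s by rewrite iotas invr_gt0.
  have ms : m.+1%:R * `|iota s| < 1.
    by rewrite gtr0_norm// iotas ltr_pdivrMr// mul1r ltr_nat ltnS leq_addl.
  have sB : B * iota s < e.
    rewrite mulrC -ltr_pdivlMr//; apply: le_lt_trans ne.
    by rewrite iotas lef_pV2 ?posrE ?ltr0n// ler_nat ltnS leq_addr.
  exists (fun j => iota s ^- k *:
      (f j (t0 + s) - \sum_(0 <= i < k) iota s ^+ i *: y j i)).
    apply/cvg_ex; eexists; apply: cvgZr; apply: cvgB; first exact: fg.
    by apply: cvg_sum_lim => i ik; exact: ih.
  move=> j; have := fy j s k.+1 ms; rewrite big_nat_recr//= opprD addrA.
  set w := _ - \sum_(0 <= _ < _) _ => wB.
  have sk0 : 0 < iota s ^+ k by rewrite exprn_gt0.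
  have -> : iota s ^- k *: w - y j k =
      iota s ^- k *: (w - iota s ^+ k *: y j k).
    by rewrite [RHS]scalerBr scalerA mulVf ?gt_eqF// scale1r.
  rewrite normrZ normfV (gtr0_norm sk0) mulrC ltr_pdivrMr//.
  apply: le_lt_trans wB _; rewrite gtr0_norm//.
  by rewrite exprMn mulrA -/B exprS mulrA ltr_pM2r.
exists (fun k => lim (y ^~ k @ \oo)) => s N ms.
apply: (@norm_lim_le _ _ (fun j =>
    f j (t0 + s) - \sum_(0 <= k < N) iota s ^+ k *: y j k)).
  by apply: cvgB; [exact: fg|exact: cvg_sum_lim].
by apply: nearW => j; exact: fy.
Qed.

Lemma real_analytic_atZB (R : realType) (K : numFieldType) (iota : R -> K)
    (Y : normedModType K) (U : set R) (f g : R -> Y) (c : K) (t0 : R) :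
  real_analytic_at iota U f t0 -> real_analytic_at iota U g t0 ->
  real_analytic_at iota U (fun t => c *: (f t - g t)) t0.
Proof.
move=> [r [y [r0 rU fy]]] [r' [y' [r'0 _ gy]]].
exists (Order.min r r'), (fun k => c *: (y k - y' k)); split.
- by rewrite lt_min r0.
- move=> t /=; rewrite in_itv/= -ltr_distlC lt_min => /andP[tr _].
  by apply: rU; rewrite /= in_itv/= -ltr_distlC.
move=> t; rewrite in_itv/= -ltr_distlC lt_min => /andP[tr tr'].
have -> : series (fun k => iota (t - t0) ^+ k *: (c *: (y k - y' k))) =
    (fun n => c *: (series (fun k => iota (t - t0) ^+ k *: y k) n -
                    series (fun k => iota (t - t0) ^+ k *: y' k) n)).
  apply/funext => n; rewrite /series/= -sumrB scaler_sumr.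
  by apply: eq_bigr => k _; rewrite -scalerBr !scalerA mulrC.
apply: cvgZr; apply: cvgB.
  by apply: fy; rewrite in_itv/= -ltr_distlC.
by apply: gy; rewrite in_itv/= -ltr_distlC.
Qed.

(** * Orbits *)

Lemma op_orbit_cvg (R : realType) (K : numFieldType) (X Y : normedModType K)
    (u : {nonneg R} -> bounded_operator X Y) (v : nat -> X) (x : X) (t : R) :
  v @ \oo --> x -> (fun j => op_orbit u (v j) t) @ \oo --> op_orbit u x t.
Proof.
by move=> vx; apply: continuous_cvg => //; exact: bounded_operator_continuous.
Qed.

Lemma closed_taylor_bounded (R : realType) (K : numFieldType)
    (iota : {rmorphism R -> K}) (KRC : real_or_complex iota)
    (X Y : completeNormedModType K) (u : {nonneg R} -> bounded_operator X Y)
    (m : nat) (t0 : R) :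
  closed [set x | exists y, taylor_bounded iota m (op_orbit u x) t0 y].
Proof.
apply: (closed_sequentially KRC) => v x /choice[y vy] vx.
by apply: (taylor_bounded_lim KRC vy) => t; exact: op_orbit_cvg.
Qed.

(** Every x is a linear combination n ((x0 + x/n) - x0) of points of the ball,
    for n large. *)
Lemma real_analytic_at_of_ball (R : realType) (K : numFieldType)
    (iota : R -> K) (KRC : real_or_complex iota)
    (X Y : normedModType K) (u : {nonneg R} -> bounded_operator X Y)
    (U : set R) (t0 : R) (x0 : X) (e : K) :
  0 < e ->
  (forall z, ball x0 e z -> real_analytic_at iota U (op_orbit u z) t0) ->
  forall x, real_analytic_at iota U (op_orbit u x) t0.
Proof.
move=> e0 anB x.
have [n nx] := scalar_archimedean KRC (divr_ge0 (normr_ge0 x) (ltW e0)).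
have n0 : 0 < n%:R :> K by apply: le_lt_trans nx; rewrite divr_ge0// ltW.
have -> : op_orbit u x =
    (fun t => n%:R *: (op_orbit u (x0 + n%:R^-1 *: x) t - op_orbit u x0 t)).
  apply/funext => t; rewrite /op_orbit (raddfD (u _))/= addrAC subrr add0r.
  by rewrite linearZ/= scalerA mulfV ?gt_eqF// scale1r.
apply: real_analytic_atZB; apply: anB; last exact: ballxx.
rewrite -ball_normE/= opprD addNKr normrN normrZ normfV (gtr0_norm n0).
by rewrite mulrC ltr_pdivrMr// mulrC -ltr_pdivrMr.
Qed.

Theorem proposition3p23 (R : realType) (K : numFieldType) (iota : R -> K)
    (KRC : real_or_complex iota) (X Y : completeNormedModType K)
    (u : {nonneg R} -> bounded_operator X Y) :
  (forall x : X, exists2 tx : R, 0 <= tx &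
     real_analytic_on iota `]0, +oo[ `]tx, +oo[ (op_orbit u x))
  <->
  (exists2 t : R, 0 <= t &
     forall x : X,
       real_analytic_on iota `]0, +oo[ `]t, +oo[ (op_orbit u x)).
Proof.
split=> [anx|[t t0 ant] x]; last by exists t.
have [h ih] := scalar_embedding_rmorphism KRC; subst iota.
apply: contrapT => Nan.
have /choice[T TP] : forall n : nat, exists t : R, n%:R < t /\
    ~ forall x, real_analytic_at h `]0, +oo[ (op_orbit u x) t.
  move=> n; apply: contrapT => Nt; apply: Nan; exists n%:R => // x t /=.
  rewrite in_itv/= andbT => nt; move: x.
  by apply: contrapT => Nx; apply: Nt; exists t.
pose A (p : nat * nat) : set X :=
  [set x | exists y, taylor_bounded h p.2 (op_orbit u x) (T p.1) y].
pose B i := if unpickle i is Some p then A p else set0.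
have [|x|i [x0 [e e0]]] := @baire_closed_cover _ _ _ KRC X B.
- move=> i; rewrite /B; case: unpickle => [p|]; last exact: closed0.
  exact: closed_taylor_bounded.
- have [tx tx0 xan] := anx x.
  have [nT _] := TP (Num.truncn tx).+1.
  have [|m [y xy]] :=
    real_analytic_taylor_bounded KRC (xan (T (Num.truncn tx).+1) _).
    by rewrite /= in_itv/= andbT; apply: lt_trans nT; rewrite truncnS_gt.
  by exists (pickle ((Num.truncn tx).+1, m)); rewrite /B pickleK; exists y.
rewrite /B; case: unpickle => [[n m]|] ballA; last first.
  exact: (ballA x0 (ballxx _ e0)).
have [nT] := TP n; apply; apply: (real_analytic_at_of_ball KRC e0) => z /ballA[y].
by apply: (taylor_bounded_real_analytic KRC); apply: le_lt_trans nT.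
Qed.
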